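(* Let $n\ge 2$, let $f\in\mathbb{R}[x_1,\ldots,x_n]$ be a nonzero polynomial of degree $d$ with leading form $f_d$, and for $N\in\mathbb{N}$ let $\varphi_N(x)=(1+x_1^2+\cdots+x_n^2)^Nf(x)$. The following conditions are equivalent: (a) $f_d(x)>0$ for all $x\in\mathbb{R}^n\setminus\{0\}$; (b) there exist $R>0$ and $N_0\in\mathbb{N}$ such that for any integer $N\ge N_0$ the polynomial $\varphi_N$ is locally strongly convex on $G=\{x\in\mathbb{R}^n:|x|>R\}$; (c) there exists $N_0\in\mathbb{N}$ such that for any integer $N\ge N_0$ the polynomial $\varphi_N$ is convex at infinity.
   Context: The leading form $f_d$ of a polynomial $f$ of degree $d$ is its homogeneous component of degree $d$ (so $f_d\ne0$). A polynomial is locally convex (resp. locally strongly convex) in an open set $G\subset\mathbb{R}^n$ if every point of $G$ has a convex neighbourhood $U$ such that the restriction of the polynomial to $U$ is convex (resp. strongly convex, i.e. there is $\mu>0$ such that subtracting $\frac{\mu}{2}|x|^2$ leaves a convex function on $U$). A polynomial is convex at infinity if there exists $R\ge 0$ such that it is locally convex in $\{x\in\mathbb{R}^n:|x|>R\}$ ($R$ may depend on the polynomial). *)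

(* Defs.v *)
From mathcomp Require Import all_boot all_order all_algebra.
From mathcomp Require Import mpoly.
From mathcomp Require Import boolp classical_sets reals topology convex.

Set Implicit Arguments.
Unset Strict Implicit.
Unset Printing Implicit Defensive.

Import Order.TTheory GRing.Theory Num.Theory.
Import numFieldTopology.Exports.

Local Open Scope classical_set_scope.
Local Open Scope ring_scope.

(* The library norm [`|x|] on ['rV_n] is the sup norm, hence
   a separate definition.  The topologies agree, so [nbhs] below is the usual
   Euclidean one. *)
Definition enorm (R : realType) (n : nat) (x : 'rV[R]_n) : R :=
  Num.sqrt (\sum_(i < n) x ord0 i ^+ 2).

Definition peval (R : realType) (n : nat) (p : {mpoly R[n]}) (x : 'rV[R]_n) : R :=
  p.@[x ord0].

(* [msize f] is the degree plus one when [f != 0], and [pihomog mdeg d f] is the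
   homogeneous component of [f] of degree [d]. *)
Definition leading_form (R : realType) (n : nat) (f : {mpoly R[n]}) :
    {mpoly R[n]} :=
  pihomog mdeg (msize f).-1 f.

Definition locally_convex (R : realType) (n : nat) (p : {mpoly R[n]})
    (G : set 'rV[R]_n) : Prop :=
  forall x, G x ->
    exists U : set 'rV[R]_n,
      [/\ nbhs x U, convex_set U & convex_function U (peval p)].

Definition locally_strongly_convex (R : realType) (n : nat) (p : {mpoly R[n]})
    (G : set 'rV[R]_n) : Prop :=
  forall x, G x ->
    exists U : set 'rV[R]_n,
      [/\ nbhs x U, convex_set U
        & exists2 mu : R, 0 < mu &
            convex_function U (fun y => peval p y - mu / 2 * enorm y ^+ 2)].

Definition convex_at_infinity (R : realType) (n : nat) (p : {mpoly R[n]}) : Prop :=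
  exists2 r : R, 0 <= r & locally_convex p [set x | r < enorm x].

Definition phi (R : realType) (n : nat) (f : {mpoly R[n]}) (N : nat) :
    {mpoly R[n]} :=
  (1 + \sum_(i < n) 'X_i ^+ 2) ^+ N * f.

(* Main.v *)
(** Along a line the evaluation of a polynomial is a univariate polynomial, so local
    convexity on an open set amounts to nonnegativity of second directional derivatives.

    If f_d > 0 off the origin then f >= c rho^d for large |x|, where rho^2 = 1 + |x|^2,
    while rho |f'(v)| and rho^2 |f''(v, v)| are O(rho^d |v|) and O(rho^d |v|^2).  In the
    second derivative of (1 + |x|^2)^N f the terms of order N^2 and N coming from the
    weight then dominate the others, for N large independently of x.

    Conversely, suppose phi_N is convex at infinity and let g = |x|^(2N) f_d be its leading
    form.  Rescaling a midpoint inequality far from the origin gives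
    2 g(x + y) <= g(2x) + g(2y) whenever x and y are nonzero with <x, y> >= 0.  Taking
    y = 3x gives g >= 0.  If f_d(x) = 0 with x nonzero, then g(y + t x) is bounded for
    t >= 1, which by the factor |y + t x|^(2N) forces the polynomial t |-> f_d(y + t x)
    to vanish; so f_d = 0, a contradiction. *)

Require Import Defs.
From mathcomp Require Import all_boot all_order all_algebra.
From mathcomp Require Import mpoly.
From mathcomp Require Import boolp classical_sets reals topology convex.
From mathcomp Require Import zify ring lra interval_inference.
From mathcomp Require polyrcf unstable normedtype derive.

Set Implicit Arguments.
Unset Strict Implicit.
Unset Printing Implicit Defensive.

Import Order.TTheory GRing.Theory Num.Theory.
Import numFieldTopology.Exports normedtype numFieldNormedType.Exports.

Local Open Scope classical_set_scope.
Local Open Scope ring_scope.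

(** * Real univariate polynomials: convexity, sign and growth *)

Section UnivariatePolynomials.
Variable R : realType.
Implicit Types (q : {poly R}) (t e a K r : R).

(** The mean value theorem for [q] on [0, t] and [t, 1] yields a < b such that the two sides differ
    by (q'(b) - q'(a)) t (1 - t); a third application, to q', gives the sign. *)
Lemma poly_convex q t :
    (forall s : R, 0 <= s <= 1 -> 0 <= q^`()^`().[s]) -> 0 <= t <= 1 ->
  q.[t] <= (1 - t) * q.[0] + t * q.[1].
Proof.
move=> q2 /andP[]; rewrite le_eqVlt => /predU1P[<- _|t0].
  by rewrite subr0 mul1r mul0r addr0.
rewrite le_eqVlt => /predU1P[->|t1].
  by rewrite subrr mul0r add0r mul1r.
have [a] := polyrcf.poly_mvt q t0; rewrite in_itv /= => /andP[a0 at_] qa.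
have [b] := polyrcf.poly_mvt q t1; rewrite in_itv /= => /andP[tb b1] qb.
have ab : a < b by exact: lt_trans tb.
have [c] := polyrcf.poly_mvt q^`() ab; rewrite in_itv /= => /andP[ac cb] qc.
have c01 : 0 <= c <= 1 by rewrite (ltW (lt_trans a0 ac)) (ltW (lt_trans cb b1)).
have : 0 <= q^`().[b] - q^`().[a] by rewrite qc mulr_ge0 ?q2 // subr_ge0 ltW.
rewrite subr0 in qa; have {}qa : q.[0] = q.[t] - q^`().[a] * t by lra.
have {}qb : q.[1] = q.[t] + q^`().[b] * (1 - t) by lra.
move=> qab; rewrite qa qb -subr_ge0.
rewrite [leRHS](_ : _ = (q^`().[b] - q^`().[a]) * (t * (1 - t))); last by ring.
by rewrite !mulr_ge0 // ?subr_ge0 ltW.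
Qed.

Lemma poly_ge0_right q e : 0 < e -> (forall t : R, 0 < t < e -> 0 <= q.[t]) ->
  0 <= q.[0].
Proof.
move=> e0 qe; rewrite leNgt; apply/negP => q0.
have [|d d0 qd] := @polyrcf.poly_cont _ 0 q (- q.[0]); first by rewrite oppr_gt0.
have m0 : 0 < Num.min d e by rewrite lt_min d0.
have m2 : Num.min d e / 2 < Num.min d e by rewrite ltr_pdivrMr // ltr_pMr // ltr1n.
have h0 : 0 < Num.min d e / 2 by rewrite divr_gt0.
move: m2; rewrite lt_min => /andP[md me].
have /qd : `|Num.min d e / 2 - 0| < d by rewrite subr0 gtr0_norm.
have : 0 <= q.[Num.min d e / 2] by rewrite qe // h0.
by rewrite ltr_norml => ? /andP[_]; lra.
Qed.

Lemma deriv2_comp_affine q t a :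
  (q \Po (a *: 'X + t%:P))^`()^`().[0] = a ^+ 2 * q^`()^`().[t].
Proof.
rewrite !(deriv_comp, derivM, derivD, derivZ, derivX, derivC).
by rewrite !(hornerD, hornerN, hornerM, horner_comp, hornerZ, hornerX, hornerC) ?hornerE /=; ring.
Qed.

(* The symmetric difference q(t + e) + q(t - e) - 2 q(t) is e^2 times a polynomial
   in e whose value at 0 is q''(t). *)
Lemma deriv2_ge0 q t e : 0 < e ->
    (forall h : R, 0 < h < e -> 2 * q.[t] <= q.[t + h] + q.[t - h]) ->
  0 <= q^`()^`().[t].
Proof.
move=> e0 qe.
pose A := (q \Po (1 *: 'X + t%:P)) + (q \Po (-1 *: 'X + t%:P)) - (2 * q.[t])%:P.
have A0 : A.[0] = 0.
  rewrite /A !(hornerD, hornerN, horner_comp, hornerZ, hornerX, hornerC).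
  by rewrite !mulr0 add0r; ring.
have A1 : A^`().[0] = 0.
  rewrite /A !(deriv_comp, derivM, derivD, derivZ, derivX, derivC, derivN).
  by rewrite !(hornerD, hornerN, hornerM, horner_comp, hornerZ, hornerX, hornerC) ?hornerE /=; ring.
have A2 : A^`()^`().[0] = 2 * q^`()^`().[t].
  rewrite /A !(derivD, derivN, derivC) !hornerD hornerN !deriv2_comp_affine horner0.
  by ring.
have /factor_theorem [B AB] : root A 0 by rewrite /root A0.
rewrite subr0 in AB.
have /factor_theorem [C BC] : root B 0.
  by move: A1; rewrite AB derivM derivX !hornerE /root => ->.
rewrite subr0 in BC; subst B.
have C0 : C.[0] = q^`()^`().[t].
  by move: A2; rewrite AB !(derivM, derivD, derivX, derivC) !hornerE /= => ?; lra.
rewrite -C0; apply: (poly_ge0_right e0) => h /andP[h0 he].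
have : A.[h] = C.[h] * h ^+ 2 by rewrite AB !hornerE /=; ring.
rewrite /A !(hornerD, hornerN, horner_comp, hornerZ, hornerX, hornerC) mul1r mulN1r => Ah.
have : 0 <= C.[h] * h ^+ 2.
  rewrite -Ah; have := qe h; rewrite h0 he => /(_ isT).
  by rewrite [t + h]addrC [t - h]addrC; lra.
by rewrite pmulr_lge0 // exprn_gt0.
Qed.

(** [D] only bounds the degree: a coefficient beyond the degree is 0, and otherwise this is the
    leading one, which fixes the sign at infinity. This replaces dividing by t^D and letting t
    grow. *)
Lemma poly_eventually_ge0_coef q D r : (size q <= D.+1)%N ->
    (forall t : R, r < t -> 0 <= q.[t]) -> 0 <= q`_D.
Proof.
move=> sq qr; rewrite leNgt; apply/negP => qD.
have szq : size q = D.+1.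
  apply/eqP; rewrite eqn_leq sq ltnNge; apply/negP => sD.
  by move: qD; rewrite nth_default ?ltxx.
have lq : lead_coef q = q`_D by rewrite lead_coefE szq.
have [|a qa] := @polyrcf.poly_pinfty_gt_lc _ (- q).
  by rewrite lead_coefN lq oppr_gt0.
have := qa (Num.max a (r + 1)); rewrite le_max lexx => /(_ isT).
have : r < Num.max a (r + 1) by rewrite lt_max ltrDl ltr01 orbT.
by move/qr; rewrite lead_coefN lq hornerN => ? ?; lra.
Qed.

(** The factor t makes even a nonzero constant [q] unbounded, so the conclusion is q = 0 rather than
    q constant. *)
Lemma bounded_mulX_poly_eq0 q K :
  (forall t : R, 1 <= t -> `|t * q.[t]| <= K) -> q = 0.
Proof.
wlog lq : q / 0 <= lead_coef q.
  move=> H qK; have [/H|lq] := leP 0 (lead_coef q); first exact.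
  apply/eqP; rewrite -oppr_eq0; apply/eqP/H => [|t t1].
    by rewrite lead_coefN oppr_ge0 ltW.
  by rewrite hornerN mulrN normrN qK.
move=> qK; apply/eqP; apply: contraT => q0.
have {}lq : 0 < lead_coef q by rewrite lt_neqAle eq_sym lead_coef_eq0 q0.
(* The leading coefficient of [p] is the positive one of [q], so [p] is eventually positive, which
   breaks the bound by [K]. *)
pose p := q * 'X - K%:P.
have lp : lead_coef p = lead_coef q.
  rewrite /p lead_coefDl ?lead_coefMX // size_mulX // size_polyN.
  by rewrite (leq_ltn_trans (size_polyC_leq1 _)) // ltnS lt0n size_poly_eq0.
have [|a pa] := @polyrcf.poly_pinfty_gt_lc _ p; first by rewrite lp.
have := pa (Num.max a 1); rewrite le_max lexx => /(_ isT).
have /qK : 1 <= Num.max a 1 by rewrite le_max lexx orbT.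
rewrite ler_norml lp /p !hornerE /= [_ * q.[_]]mulrC => /andP[_ ? ?].
by exfalso; lra.
Qed.

End UnivariatePolynomials.

(** Reduces statements stable under ring operations (evaluation on lines, the chain rule,
    continuity) to constants and variables. *)
Lemma mpoly_ring_ind (R : nzRingType) (n : nat) (P : {mpoly R[n]} -> Prop) :
    (forall c, P c%:MP) -> (forall i, P 'X_i) ->
    (forall p q, P p -> P q -> P (p + q)) ->
    (forall p q, P p -> P q -> P (p * q)) ->
  forall p, P p.
Proof.
move=> PC PX PD PM; elim/mpolyind => [|c m p _ _ Pp]; first by rewrite -mpolyC0.
apply: (PD) => //; rewrite -mul_mpolyC; apply: (PM) => //; rewrite mpolyXE_id.
have P1 : P 1 by rewrite -mpolyC1.
elim/big_ind: _ => // i _; elim: (m i) => [|k IHk]; first by rewrite expr0.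
by rewrite exprS; apply: (PM).
Qed.

(** * Restriction of polynomials to lines, and directional derivatives *)

Section Lines.
Variables (R : realType) (n : nat).
Implicit Types (p f : {mpoly R[n]}) (x y v : 'rV[R]_n).

Definition dot x y : R := \sum_(i < n) x ord0 i * y ord0 i.

Lemma dotC x y : dot x y = dot y x.
Proof. by apply: eq_bigr => i _; rewrite mulrC. Qed.

Lemma dotDr x y v : dot v (x + y) = dot v x + dot v y.
Proof. by rewrite -big_split; apply: eq_bigr => i _; rewrite mxE mulrDr. Qed.

Lemma dotZr a x y : dot x (a *: y) = a * dot x y.
Proof. by rewrite mulr_sumr; apply: eq_bigr => i _; rewrite mxE mulrCA. Qed.

Lemma dotDl x y v : dot (x + y) v = dot x v + dot y v.
Proof. by rewrite dotC dotDr !(dotC v). Qed.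

Lemma dotZl a x y : dot (a *: x) y = a * dot x y.
Proof. by rewrite dotC dotZr dotC. Qed.

Lemma dot_ge0 x : 0 <= dot x x.
Proof. by apply: sumr_ge0 => i _; rewrite -expr2 sqr_ge0. Qed.

Lemma dot_gt0 x : x != 0 -> 0 < dot x x.
Proof.
move=> x0; rewrite lt_neqAle dot_ge0 andbT eq_sym; apply: contraNneq x0 => d0.
apply/eqP/rowP => i; rewrite mxE; apply/eqP.
rewrite -sqrf_eq0 eq_le sqr_ge0 andbT -d0 /dot (bigD1 i) //= -expr2 lerDl.
by apply: sumr_ge0 => j _; rewrite -expr2 sqr_ge0.
Qed.

Lemma enorm_sqr x : enorm x ^+ 2 = dot x x.
Proof. by rewrite sqr_sqrtr; [|exact: dot_ge0]; apply: eq_bigr => i _; rewrite expr2. Qed.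

Lemma lt_enorm (r : R) x : 0 <= r -> (r < enorm x) = (r ^+ 2 < dot x x).
Proof. by move=> r0; rewrite -enorm_sqr ltr_sqr ?nnegrE ?sqrtr_ge0. Qed.

(** The map t |-> p(x + t v), encoded as a substitution so that it is a ring morphism in [p]. *)
Definition line p x v : {poly R} :=
  mmap (@polyC R) (fun i => (x ord0 i)%:P + v ord0 i *: 'X) p.

Definition dir1 p x v : R := \sum_(i < n) v ord0 i * peval p^`M(i) x.

(** The Hessian form of [p] at [x], evaluated at (v, v). *)
Definition dir2 p x v : R :=
  \sum_(i < n) \sum_(j < n) v ord0 i * v ord0 j * peval p^`M(i)^`M(j) x.

Definition dot_line x v : {poly R} :=
  \sum_(i < n) ((x ord0 i)%:P + v ord0 i *: 'X) ^+ 2.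

Lemma lineD p f x v : line (p + f) x v = line p x v + line f x v.
Proof. exact: mmapD. Qed.

Lemma lineM p f x v : line (p * f) x v = line p x v * line f x v.
Proof. exact: rmorphM. Qed.

Lemma lineE p x v (t : R) : (line p x v).[t] = peval p (x + t *: v).
Proof.
elim/mpoly_ring_ind: p => [c|i|p q IHp IHq|p q IHp IHq]; rewrite /line /peval.
- by rewrite mmapC mevalC hornerC.
- by rewrite mmapX mmap1U mevalXU !hornerE !mxE mulrC.
- by rewrite mmapD mevalD hornerD; congr (_ + _).
- by rewrite rmorphM mevalM hornerM; congr (_ * _).
Qed.

Lemma deriv_line p x v : (line p x v)^`() = \sum_(i < n) v ord0 i *: line p^`M(i) x v.
Proof.
elim/mpoly_ring_ind: p => [c|i|p q IHp IHq|p q IHp IHq]; rewrite /line.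
- rewrite mmapC derivC big1 // => i _; by rewrite mderivC mmap0 scaler0.
- rewrite mmapX mmap1U derivD derivC derivZ derivX add0r (bigD1 i) //=.
  rewrite big1 ?addr0 => [|j ji].
    by rewrite mderivX mnm1E eqxx scale1r -{1}[U_(i)%MM]add0m addmK mmapX mmap11.
  by rewrite mderivX mnm1E eq_sym (negPf ji) scale0r mmap0 scaler0.
- rewrite -/(line _ x v) lineD derivD IHp IHq -big_split; apply: eq_bigr => i _ /=.
  by rewrite -/(line _ x v) mderivD lineD scalerDr.
- rewrite -/(line _ x v) lineM derivM IHp IHq mulr_suml mulr_sumr -big_split.
  apply: eq_bigr => i _ /=.
  by rewrite -/(line _ x v) mderivM lineD !lineM scalerDr scalerAl scalerAr.
Qed.

Lemma deriv_lineE p x v (t : R) : (line p x v)^`().[t] = dir1 p (x + t *: v) v.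
Proof.
rewrite deriv_line horner_sum; apply: eq_bigr => i _.
by rewrite hornerZ lineE.
Qed.

Lemma deriv2_lineE p x v (t : R) : (line p x v)^`()^`().[t] = dir2 p (x + t *: v) v.
Proof.
rewrite deriv_line raddf_sum horner_sum; apply: eq_bigr => i _ /=.
rewrite derivZ hornerZ deriv_lineE mulr_sumr.
by apply: eq_bigr => j _; rewrite mulrA.
Qed.

Lemma dot_lineE x v (t : R) : (dot_line x v).[t] = dot (x + t *: v) (x + t *: v).
Proof.
rewrite horner_sum; apply: eq_bigr => i _.
by rewrite !hornerE !mxE -expr2 (mulrC t).
Qed.

Lemma deriv_dot_lineE x v (t : R) : (dot_line x v)^`().[t] = 2 * dot (x + t *: v) v.
Proof.
rewrite raddf_sum horner_sum mulr_sumr; apply: eq_bigr => i _ /=.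
by rewrite !derivE !hornerE /= !mxE; ring.
Qed.

Lemma deriv2_dot_lineE x v (t : R) : (dot_line x v)^`()^`().[t] = 2 * dot v v.
Proof.
rewrite !raddf_sum horner_sum mulr_sumr; apply: eq_bigr => i _ /=.
by rewrite !derivE !hornerE /=; ring.
Qed.

Lemma line_phi f N x v : line (phi f N) x v = (1 + dot_line x v) ^+ N * line f x v.
Proof.
rewrite /line /phi rmorphM rmorphXn; congr (_ ^+ _ * _).
rewrite rmorphD rmorph1 raddf_sum; congr (_ + _); apply: eq_bigr => i _ /=.
by rewrite rmorphXn /= mmapX mmap1U.
Qed.

(** The exponent [M.+2] allows two derivatives without truncated subtraction, and S^M factors out of
    every term. *)
Lemma deriv2_exprM (S F : {poly R}) M :
  (S ^+ M.+2 * F)^`()^`() = S ^+ M *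
    (S^`() ^+ 2 * F *+ (M.+2 * M.+1) + S * S^`()^`() * F *+ M.+2
       + S * S^`() * F^`() *+ (2 * M.+2) + S ^+ 2 * F^`()^`()).
Proof.
have E1 : (S ^+ M.+2 * F)^`() = S ^+ M.+1 * (S^`() * F *+ M.+2 + S * F^`()).
  rewrite derivM deriv_exp /= !exprS.
  by move: (S ^+ M) S^`() F^`() => P S1 F1; ring.
rewrite E1 derivM deriv_exp /= derivD derivMn !derivM !exprS.
move: (S ^+ M) S^`() S^`()^`() F^`() F^`()^`() => P S1 S2 F1 F2.
ring.
Qed.

(** On the line through [x], the weight 1 + |x + t v|^2 has at t = 0 the value s, first derivative 2
    <x, v> and second derivative 2 |v|^2. *)
Lemma dir2_phi f M x v : let s := 1 + dot x x in
  dir2 (phi f M.+2) x v = s ^+ M *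
    (4 * (M.+2)%:R * (M.+1)%:R * dot x v ^+ 2 * peval f x
     + 2 * (M.+2)%:R * s * dot v v * peval f x
     + 4 * (M.+2)%:R * s * dot x v * dir1 f x v + s ^+ 2 * dir2 f x v).
Proof.
move=> s; rewrite -[in LHS](addr0 x) -(scale0r v) -deriv2_lineE line_phi.
have -> : s = (1 + dot_line x v).[0] by rewrite hornerD hornerC dot_lineE scale0r addr0.
rewrite deriv2_exprM !(derivD, derivC, add0r).
have eS1 : 2 * dot x v = (dot_line x v)^`().[0] by rewrite deriv_dot_lineE scale0r addr0.
have eS2 : 2 * dot v v = (dot_line x v)^`()^`().[0] by rewrite deriv2_dot_lineE.
have -> : peval f x = (line f x v).[0] by rewrite lineE scale0r addr0.
have -> : dir1 f x v = (line f x v)^`().[0] by rewrite deriv_lineE scale0r addr0.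
have -> : dir2 f x v = (line f x v)^`()^`().[0] by rewrite deriv2_lineE scale0r addr0.
set S := 1 + dot_line x v.
move: M.+2 => k; move: M.+1 => l.
rewrite !(hornerM, hornerD, horner_exp, hornerMn) -eS1 -eS2.
ring.
Qed.

End Lines.

(** * Local convexity and second directional derivatives *)

Section Convexity.
Variables (R : realType) (n : nat).
Implicit Types (p f : {mpoly R[n]}) (x y v : 'rV[R]_n) (U G : set 'rV[R]_n).

(** The weight [t] falls on the first point, so segments start at [y] with direction x - y. *)
Lemma conv_rV x y (t : {i01 R}) :
  conv t (x : convex_lmodType 'rV[R]_n) y = y + t%:num *: (x - y).
Proof.
rewrite /conv /=; rewrite scalerBr /unstable.onem scalerBl scale1r.
by rewrite addrCA addrA addrAC -addrA.
Qed.

(** Along a segment of direction v the term mu/2 |.|^2 has second derivative mu |v|^2, so the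
    difference has a nonnegative one and [poly_convex] applies. *)
Lemma convex_function_dir2 p U (mu : R) :
    convex_set U -> (forall y v, U y -> mu * dot v v <= dir2 p y v) ->
  convex_function U (fun y => peval p y - mu / 2 * enorm y ^+ 2).
Proof.
move=> cU pU t x y xU yU.
have segU s : 0 <= s <= 1 -> U (y + s *: (x - y)).
  move=> /andP[s0 s1]; have := cU x y (Itv01 s0 s1) xU yU.
  by rewrite conv_rV inE.
pose q := line p y (x - y) - (mu / 2) *: dot_line y (x - y).
have qE s : q.[s] = peval p (y + s *: (x - y)) - mu / 2 * enorm (y + s *: (x - y)) ^+ 2.
  by rewrite enorm_sqr !(hornerD, hornerN, hornerZ) lineE dot_lineE.
have := @poly_convex _ q t%:num; rewrite !qE scale0r addr0 scale1r subrKC.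
move=> qc; rewrite conv_rV convRE /unstable.onem [leRHS]addrC.
apply: qc => [s s01|]; last by rewrite ge0 le1.
rewrite !(derivB, derivZ) hornerD hornerN hornerZ.
rewrite deriv2_lineE deriv2_dot_lineE subr_ge0.
rewrite (le_trans _ (pU _ (x - y) (segU _ s01))) //; lra.
Qed.

Lemma nbhs_rV_line U x v : nbhs x U ->
  exists2 e : R, 0 < e & forall h, `|h| < e -> U (x + h *: v).
Proof.
move=> /nbhs_ballP [d /= d0 dU].
have S0 : 0 <= \sum_(i < n) `|v ord0 i| by apply: sumr_ge0.
have S1 : 0 < 1 + \sum_(i < n) `|v ord0 i| by rewrite ltr_pwDl.
(* Balls are those of the sup norm: the sum dominates every |v_i|, and the 1 keeps the denominator
   positive when v = 0. *)
exists (d / (1 + \sum_(i < n) `|v ord0 i|)) => [|h hd]; first by rewrite divr_gt0.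
apply: dU; split=> // i j; rewrite ord1 !mxE /ball /= opprD addrA subrr sub0r normrN normrM.
rewrite (le_lt_trans _ (_ : `|h| * (1 + \sum_(i < n) `|v ord0 i|) < d)) //.
  rewrite ler_wpM2l // (bigD1 j) //= addrCA lerDl addr_ge0 //.
  by apply: sumr_ge0.
by rewrite -ltr_pdivlMr.
Qed.

(** The midpoint inequality between x + h v and x - h v, for small h, is the symmetric difference
    inequality of [deriv2_ge0]. *)
Lemma locally_convex_dir2_ge0 p G x v : Defs.locally_convex p G -> G x -> 0 <= dir2 p x v.
Proof.
move=> pG /pG [U [xU cU pU]].
have [e e0 eU] := nbhs_rV_line v xU.
rewrite -[x in dir2 _ x](addr0 x) -(scale0r v) -deriv2_lineE.
apply: (deriv2_ge0 e0) => h /andP[h0 he].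
rewrite !lineE add0r sub0r scale0r addr0.
have Up : (x + h *: v) \in U by rewrite inE; apply: eU; rewrite gtr0_norm.
have Um : (x + - h *: v) \in U by rewrite inE; apply: eU; rewrite normrN gtr0_norm.
have l0 : 0 <= 2^-1 :> R by rewrite invr_ge0.
have l1 : 2^-1 <= 1 :> R by rewrite invf_le1 ?ler1n.
have := pU (Itv01 l0 l1) _ _ Up Um.
rewrite conv_rV convRE /= /unstable.onem.
have -> : x + - h *: v + 2^-1 *: (x + h *: v - (x + - h *: v)) = x.
  apply/rowP => i; rewrite !mxE; lra.
move: (peval _ _) (peval _ _) (peval _ _) => a b c; lra.
Qed.

End Convexity.

(** * Homogeneous components and the leading form *)

Section LeadingForm.
Variables (R : realType) (n : nat).
Implicit Types (p f : {mpoly R[n]}) (x y v : 'rV[R]_n).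

Lemma peval_pihomog d f x : peval (pihomog mdeg d f) x =
  \sum_(m <- msupp f | mdeg m == d) f@_m * \prod_(i < n) x ord0 i ^+ m i.
Proof.
rewrite pihomogE /peval raddf_sum /=; apply: eq_bigr => m _.
by rewrite mevalZ mevalX.
Qed.

Lemma prod_scale_mnm (a : R) x (m : 'X_{1..n}) :
  \prod_(i < n) (a *: x) ord0 i ^+ m i = a ^+ mdeg m * \prod_(i < n) x ord0 i ^+ m i.
Proof.
rewrite mdegE -prodrXr -big_split; apply: eq_bigr => i _.
by rewrite mxE exprMn.
Qed.

Lemma peval_pihomogZ d f (a : R) x :
  peval (pihomog mdeg d f) (a *: x) = a ^+ d * peval (pihomog mdeg d f) x.
Proof.
rewrite !peval_pihomog mulr_sumr; apply: eq_bigr => m /eqP <-.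
by rewrite prod_scale_mnm mulrCA.
Qed.

Lemma mcoeff_pihomog d f m : (pihomog mdeg d f)@_m = if mdeg m == d then f@_m else 0.
Proof.
rewrite pihomogE raddf_sum /=; under eq_bigr do rewrite mcoeffZ mcoeffX.
have [mf|mf] := boolP (m \in msupp f); last first.
  rewrite (memN_msupp_eq0 mf) if_same big_seq_cond big1 // => i /andP[i_f _].
  by case: eqP mf => [<-|_]; rewrite ?i_f ?mulr0.
rewrite big_mkcond (bigD1_seq m) ?msupp_uniq //= eqxx mulr1 big1 ?addr0 // => i im.
by rewrite (negPf im) mulr0 if_same.
Qed.

Lemma leading_form_neq0 f : f != 0 -> leading_form f != 0.
Proof.
move=> f0; apply: contraTneq (mlead_supp f0) => L0.
rewrite mcoeff_msupp negbK -[f@__](_ : (leading_form f)@_(mlead f) = _).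
  by rewrite L0 mcoeff0.
by rewrite mcoeff_pihomog -(mlead_deg f0) eqxx.
Qed.

(** With base point 0 the line is t |-> f(t x), so its coefficient of degree k is the homogeneous
    component of degree k at [x]. *)
Lemma line0E f x : line f 0 x =
  \sum_(m <- msupp f) (f@_m * \prod_(i < n) x ord0 i ^+ m i) *: 'X^(mdeg m).
Proof.
apply: eq_bigr => m _; rewrite -mul_polyC rmorphM -mulrA; congr (_ * _).
rewrite mdegE -prodrXr rmorph_prod -big_split; apply: eq_bigr => i _ /=.
by rewrite mxE add0r exprZn -mul_polyC.
Qed.

Lemma size_line0 f x : (size (line f 0 x) <= msize f)%N.
Proof.
rewrite line0E big_seq; apply: (leq_trans (size_sum _ _ _)).
apply/bigmax_leqP_seq => m _ mf; rewrite (leq_trans (size_scale_leq _ _)) //.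
by rewrite size_polyXn msize_mdeg_lt.
Qed.

Lemma coef_line0 d f x : (line f 0 x)`_d = peval (pihomog mdeg d f) x.
Proof.
rewrite line0E peval_pihomog coef_sum [RHS]big_mkcond; apply: eq_bigr => m _.
by rewrite coefZ coefXn eq_sym; case: eqP; rewrite ?mulr1 ?mulr0.
Qed.

(** Induction on the degree of the monomial [m]: the partial derivatives of [p] vanish everywhere
    too, and one of them has, at a monomial of lower degree, a positive integer multiple of the
    coefficient of [m]. *)
Lemma mpoly_vanish p : (forall x, peval p x = 0) -> p = 0.
Proof.
move=> p0; apply/mpolyP => m; rewrite mcoeff0.
elim: {m}(mdeg m) {-2}m (erefl (mdeg m)) p p0 => [|k IHk] m mk p p0.
  have -> : m = 0%MM by apply/eqP; rewrite -mdeg_eq0 mk.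
  have pE : pihomog mdeg 0 p = (p@_0)%:MP.
    apply/mpolyP => m'; rewrite mcoeff_pihomog mcoeffC mdeg_eq0 eq_sym.
    by case: eqP => [<-|_]; rewrite ?mulr1 ?mulr0.
  rewrite -[LHS](mevalC ((0 : 'rV[R]_n) ord0)) -pE -/(peval _ _) -coef_line0.
  by rewrite -horner_coef0 lineE p0.
have [i mi] : exists i, m i != 0%N.
  apply/existsP; apply: contra_eqT mk; rewrite negb_exists => /forallP m0.
  by rewrite mdegE big1 // => i _; apply/eqP; have := m0 i; rewrite negbK.
have um : (U_(i) <= m)%MM by rewrite lep1mP.
have dp x : peval p^`M(i) x = 0.
  have l0 : line p x (delta_mx ord0 i) = 0.
    by apply: (@bounded_mulX_poly_eq0 _ _ 0) => t _; rewrite lineE p0 mulr0 normr0.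
  have := deriv_lineE p x (delta_mx ord0 i) 0.
  rewrite l0 derivC horner0 scale0r addr0 /dir1 (bigD1 i) //= big1 ?addr0.
    by rewrite mxE !eqxx mul1r.
  by move=> j ji; rewrite mxE (negPf ji) andbF mul0r.
have md : mdeg (m - U_(i))%MM = k.
  by have := congr1 mdeg (submK um); rewrite mdegD mdeg1 addn1 mk => -[].
have := IHk _ md _ dp; rewrite mcoeff_deriv submK // => /eqP.
by rewrite mulrn_eq0 => /eqP.
Qed.

End LeadingForm.

(** * Growth of polynomials and of their derivatives *)

Section Growth.
Variables (R : realType) (n : nat).
Implicit Types (p f : {mpoly R[n]}) (x y v : 'rV[R]_n).

(** rho^2 is the weight in [phi]; since rho >= 1, its powers increase with the exponent, also near
    the origin. *)
Definition rho x : R := Num.sqrt (1 + dot x x).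

Lemma sqr_rho x : rho x ^+ 2 = 1 + dot x x.
Proof. by rewrite sqr_sqrtr // addr_ge0 // dot_ge0. Qed.

Lemma rho_ge1 x : 1 <= rho x.
Proof. by rewrite -(@ler_sqr _ 1) ?nnegrE ?sqrtr_ge0 // expr1n sqr_rho lerDl dot_ge0. Qed.

Lemma enorm_ge0 x : 0 <= enorm x.
Proof. exact: sqrtr_ge0. Qed.

Lemma normr_coord x i : `|x ord0 i| <= enorm x.
Proof.
rewrite -(ler_sqr (normr_ge0 _) (enorm_ge0 x)) real_normK ?num_real // enorm_sqr.
rewrite /dot (bigD1 i) //= -expr2 lerDl.
by apply: sumr_ge0 => j _; rewrite -expr2 sqr_ge0.
Qed.

Lemma enorm_le_rho x : enorm x <= rho x.
Proof.
rewrite -ler_sqr ?nnegrE ?enorm_ge0 ?(le_trans ler01 (rho_ge1 x)) //.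
by rewrite enorm_sqr sqr_rho lerDr.
Qed.

(** A monomial of degree e is at most rho^e in absolute value. Having rho^k on the left avoids the
    subtraction d - k; if d < k the hypothesis forces p = 0. *)
Lemma peval_bound p k d : (forall m, m \in msupp p -> (mdeg m + k <= d)%N) ->
  exists2 C : R, 0 <= C & forall x, `|peval p x| * rho x ^+ k <= C * rho x ^+ d.
Proof.
move=> pd; exists (\sum_(m <- msupp p) `|p@_m|) => [|x]; first exact: sumr_ge0.
have r1 := rho_ge1 x; have r0 := le_trans ler01 r1.
rewrite /peval mevalE mulr_suml.
apply: (le_trans (ler_wpM2r (exprn_ge0 k r0) (ler_norm_sum _ _ _))).
rewrite mulr_suml [leLHS]big_seq [leRHS]big_seq; apply: ler_sum => m mp.
rewrite normrM -mulrA ler_wpM2l //.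
apply: (@le_trans _ _ (rho x ^+ mdeg m * rho x ^+ k)); last first.
  by rewrite -exprD ler_weXn2l ?pd.
rewrite ler_wpM2r ?exprn_ge0 // normr_prod mdegE -prodrXr.
apply: ler_prod => i _; rewrite normrX exprn_ge0 //= lerXn2r ?nnegrE //.
exact: le_trans (normr_coord x i) (enorm_le_rho x).
Qed.

Lemma msupp_mderiv p i m : m \in msupp p^`M(i) -> (m + U_(i))%MM \in msupp p.
Proof.
by rewrite !mcoeff_msupp mcoeff_deriv; apply: contraNneq => ->; rewrite mul0rn.
Qed.

Lemma msupp_leq f m : m \in msupp f -> (mdeg m <= (msize f).-1)%N.
Proof. by move=> mf; rewrite -ltnS (ltn_predK (msize_mdeg_lt mf)) msize_mdeg_lt. Qed.

Lemma dir1_bound f : exists2 C : R, 0 <= C &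
  forall x v, `|dir1 f x v| * rho x <= C * rho x ^+ (msize f).-1 * enorm v.
Proof.
have /fin_all_exists2[C C0 CP] i : exists2 C : R, 0 <= C & forall x,
    `|peval f^`M(i) x| * rho x ^+ 1 <= C * rho x ^+ (msize f).-1.
  apply: peval_bound => m /msupp_mderiv /msupp_leq.
  by rewrite mdegD mdeg1.
exists (\sum_i C i) => [|x v]; first exact: sumr_ge0.
rewrite (le_trans (ler_wpM2r _ (ler_norm_sum _ _ _))) ?(le_trans ler01 (rho_ge1 x)) //.
rewrite !mulr_suml; apply: ler_sum => i _.
rewrite normrM -mulrA [leRHS]mulrC ler_pM ?mulr_ge0 ?normr_coord //.
  by rewrite (le_trans ler01 (rho_ge1 x)).
Qed.

Lemma dir2_bound f : exists2 C : R, 0 <= C &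
  forall x v, `|dir2 f x v| * rho x ^+ 2 <= C * rho x ^+ (msize f).-1 * dot v v.
Proof.
have /fin_all_exists2[C C0 CP] ij : exists2 C : R, 0 <= C & forall x,
    `|peval f^`M(ij.1)^`M(ij.2) x| * rho x ^+ 2 <= C * rho x ^+ (msize f).-1.
  apply: peval_bound => m /msupp_mderiv /msupp_mderiv /msupp_leq.
  by rewrite !mdegD !mdeg1 -addnA.
exists (\sum_ij C ij) => [|x v]; first exact: sumr_ge0.
rewrite /dir2 pair_bigA /= (le_trans (ler_wpM2r _ (ler_norm_sum _ _ _))) ?sqr_ge0 //.
rewrite !mulr_suml; apply: ler_sum => ij _.
rewrite normrM -mulrA [leRHS]mulrC ler_pM ?mulr_ge0 ?sqrtr_ge0 //.
by rewrite normrM -enorm_sqr expr2 ler_pM ?normr_coord.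
Qed.

Lemma continuous_peval p : continuous (peval p : 'rV[R]_n -> R).
Proof.
elim/mpoly_ring_ind: p => [c|i|p q IHp IHq|p q IHp IHq] x.
- rewrite (_ : peval _ = fun=> c); first exact: cst_continuous.
  by apply/funext => y; rewrite /peval mevalC.
- rewrite (_ : peval _ = fun y : 'rV[R]_n => y ord0 i); first exact: coord_continuous.
  by apply/funext => y; rewrite /peval mevalXU.
- rewrite (_ : peval _ = peval p \+ peval q); first exact: cvgD (IHp x) (IHq x).
  by apply/funext => y; rewrite /peval mevalD.
- rewrite (_ : peval _ = peval p \* peval q); first exact: cvgM (IHp x) (IHq x).
  by apply/funext => y; rewrite /peval mevalM.
Qed.

Lemma continuous_dot : continuous (fun x : 'rV[R]_n => dot x x).
Proof.
rewrite (_ : (fun x => _) = peval (\sum_(i < n) 'X_i ^+ 2)); first exact: continuous_peval.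
apply/funext => x; rewrite /peval raddf_sum; apply: eq_bigr => i _ /=.
by rewrite rmorphXn /= mevalXU expr2.
Qed.

Lemma compact_unit_sphere : compact [set x : 'rV[R]_n | dot x x = 1].
Proof.
pose box := [set x : 'rV[R]_n | forall i, `[-1 : R, 1]%classic (x ord0 i)].
have cbox : compact box.
  by apply: (@rV_compact _ _ (fun=> `[-1 : R, 1]%classic)) => i; exact: segment_compact.
apply: subclosed_compact cbox _ => [|x /= x1 i].
  rewrite (_ : [set x | _] = (fun x => dot x x) @^-1` [set 1 : R]) //.
  apply: preimage_closed; last exact: closed_eq.
  by move=> x _; exact: continuous_dot.
rewrite /= in_itv /= -ler_norml (le_trans (normr_coord x i)) //.
by rewrite -(@ler_sqr _ _ 1) ?nnegrE ?enorm_ge0 // enorm_sqr x1 expr1n.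
Qed.

(** By compactness the form has a positive minimum on the unit sphere, and homogeneity carries it to
    |x| >= 1. *)
Lemma leading_form_lower_bound d f :
    (forall x, x != 0 -> 0 < peval (pihomog mdeg d f) x) ->
  exists2 c : R, 0 < c &
    forall x, 1 <= dot x x -> c * rho x ^+ d <= peval (pihomog mdeg d f) x.
Proof.
move=> L0; set L := pihomog mdeg d f.
have normalize x : 1 <= dot x x -> dot ((enorm x)^-1 *: x) ((enorm x)^-1 *: x) = 1.
  move=> x1; rewrite dotZl dotZr mulrA -expr2 -enorm_sqr exprVn mulVf //.
  by rewrite enorm_sqr gt_eqF // (lt_le_trans ltr01).
have [c c0 cP] : exists2 c : R, 0 < c & forall x, dot x x = 1 -> c <= peval L x.
  have [S0|S0] := pselect ([set x : 'rV[R]_n | dot x x = 1] !=set0); last first.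
    (* An empty sphere (dimension 0) admits any positive constant. *)
    by exists 1 => // x x1; case: S0; exists x.
  have [|u] := derive.compact_EVT_min S0 compact_unit_sphere (f := peval L).
    exact/continuous_subspaceT/continuous_peval.
  rewrite inE => /= u1 uP; exists (peval L u) => [|x x1].
    apply: L0; apply: contraPneq u1 => ->.
    by rewrite -[0](scale0r 0) dotZl mul0r => /eqP; rewrite eq_sym oner_eq0.
  by apply: uP; rewrite inE.
(* The factor 2^d comes from rho <= 2 |x| for |x| >= 1. *)
exists (c / 2 ^+ d) => [|x x1]; first by rewrite divr_gt0 // exprn_gt0.
have e1 : 1 <= enorm x by rewrite -(@ler_sqr _ 1) ?nnegrE ?enorm_ge0 // expr1n enorm_sqr.
have e0 : 0 < enorm x by rewrite (lt_le_trans ltr01).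
rewrite mulrAC -mulrA -expr_div_n -[x in leRHS](scalerKV (lt0r_neq0 e0)).
rewrite peval_pihomogZ [leRHS]mulrC ler_pM ?(ltW c0) ?cP ?normalize //.
  by rewrite exprn_ge0 // divr_ge0 ?sqrtr_ge0.
rewrite lerXn2r ?nnegrE ?divr_ge0 ?enorm_ge0 ?sqrtr_ge0 // ler_pdivrMr //.
rewrite -ler_sqr ?nnegrE ?mulr_ge0 ?enorm_ge0 ?sqrtr_ge0 // sqr_rho exprMn enorm_sqr.
lra.
Qed.

End Growth.

(** * Strong convexity of [phi f N] for large N *)

Section StrongConvexity.
Variables (R : realType) (n : nat).
Implicit Types (p f : {mpoly R[n]}) (x y v : 'rV[R]_n) (U G : set 'rV[R]_n).

Lemma lower_bound_at_infinity f : f != 0 ->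
    (forall x, x != 0 -> 0 < peval (leading_form f) x) ->
  exists2 c : R, 0 < c & exists2 r : R, 1 <= r &
    forall x, r < enorm x -> c * rho x ^+ (msize f).-1 <= peval f x.
Proof.
move=> f0 L0; set d := (msize f).-1.
have [c c0 cP] := leading_form_lower_bound L0.
have [C C0 CP] : exists2 C : R, 0 <= C & forall x,
    `|peval (f - leading_form f) x| * rho x ^+ 1 <= C * rho x ^+ d.
  apply: peval_bound => m; rewrite mcoeff_msupp mcoeffB mcoeff_pihomog.
  have [_|md] := eqVneq (mdeg m) d; first by rewrite subrr eqxx.
  by rewrite subr0 -mcoeff_msupp => /msupp_leq; rewrite addn1 ltn_neqAle md.
exists (c / 2); first by rewrite divr_gt0.
(* Past 2 C / c the lower-order remainder is at most half of c rho^d; the bound on the leading form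
   asks for |x| >= 1. *)
exists (Num.max 1 (2 * C / c)); first by rewrite le_max lexx.
move=> x; rewrite gt_max => /andP[x1 xC].
have rx := enorm_le_rho x.
have r0 : 0 < rho x by rewrite (lt_le_trans ltr01) ?rho_ge1.
have {}xC : 2 * C <= c * rho x.
  by rewrite [leRHS]mulrC -ler_pdivrMr // (le_trans (ltW xC)).
have C2 : C <= c / 2 * rho x by lra.
have x2 : 1 <= dot x x.
  by rewrite -enorm_sqr -(expr1n _ 2) ler_sqr ?nnegrE ?enorm_ge0 // ltW.
have -> : peval f x = peval (leading_form f) x + peval (f - leading_form f) x.
  by rewrite /peval -mevalD subrKC.
have P0 : 0 < rho x ^+ d by rewrite exprn_gt0.
have := CP x; rewrite expr1; set g := peval (f - _) x => CPx.
have : `|g| <= c / 2 * rho x ^+ d.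
  rewrite -(ler_pM2r r0); apply: (le_trans CPx).
  move: (rho x ^+ d) P0 => P P0; rewrite (_ : c / 2 * _ * _ = c / 2 * rho x * P); last by ring.
  by rewrite ler_pM2r.
rewrite ler_norml => /andP[gl _]; clear CPx.
have := cP x x2; rewrite -/(leading_form f).
by move: (peval _ _) (rho x ^+ d) P0 gl => L P P0 gl; lra.
Qed.

(** Completing the square absorbs the cross term: with A = |a|, 4 k l A^2 - 4 k K A b + k b^2 = 4 k
    (l - K^2) A^2 + k (2 K A - b)^2, and another k b^2 remains to cover (K + 1) b^2. *)
Lemma quadratic_form_ge (k l K F a b u w : R) : 0 <= k -> K ^+ 2 <= l -> K + 1 <= k ->
    0 <= F -> - (K * F * `|a| * b) <= u -> - (K * F * b ^+ 2) <= w ->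
  F * b ^+ 2 <= 4 * k * l * a ^+ 2 * F + 2 * k * b ^+ 2 * F + 4 * k * u + w.
Proof.
move=> k0 Kl Kk F0 uP wP; rewrite -(real_normK (num_real a)).
move: (`|a|) uP => A uP.
have {}uP : 4 * k * - (K * F * A * b) <= 4 * k * u by rewrite ler_wpM2l ?mulr_ge0.
have : 0 <= F * (4 * k * (l - K ^+ 2) * A ^+ 2 + k * (2 * K * A - b) ^+ 2
                 + (k - (K + 1)) * b ^+ 2).
  apply: mulr_ge0 => //; apply: addr_ge0; [apply: addr_ge0|];
    apply: mulr_ge0; rewrite ?sqr_ge0 ?subr_ge0 //.
  by rewrite mulr_ge0 ?subr_ge0 // mulr_ge0.
lra.
Qed.

(* With a = |dot x v|, b = rho x * enorm v and K such that rho |f'(v)| <= K f |v| and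
   rho^2 |f''(v, v)| <= K f |v|^2, the Hessian form of phi f N divided by
   rho^(2 (N - 2)) f is at least
   4 N (N - 1) a^2 - 4 N K a b + (2 N - K) b^2 >= b^2 for large N. *)
Lemma dir2_phi_ge f : f != 0 ->
    (forall x, x != 0 -> 0 < peval (leading_form f) x) ->
  exists2 mu : R, 0 < mu & exists2 r : R, 0 < r & exists N0 : nat,
    forall N x v, (N0 <= N)%N -> r < enorm x -> mu * dot v v <= dir2 (phi f N) x v.
Proof.
move=> f0 L0; have [c c0 [r r1 fP]] := lower_bound_at_infinity f0 L0.
have [C1 C10 D1P] := dir1_bound f; have [C2 C20 D2P] := dir2_bound f.
pose K := (C1 + C2) / c.
have K0 : 0 <= K by rewrite divr_ge0 ?addr_ge0 // ltW.
(* The modulus c works because s^M >= 1, b^2 >= |v|^2 and f >= c rho^d >= c. *)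
exists c => //; exists r; first exact: lt_le_trans r1.
(* With N = M + 2 this makes M >= K^2 + K + 1, enough for both K^2 <= N - 1 and K + 1 <= N. *)
exists (Num.bound (K ^+ 2 + K + 1)).+2 => -[|[|M]] // x v; rewrite !ltnS => NM rx.
have M0 : K ^+ 2 + K + 1 <= M%:R.
  apply: (@le_trans _ _ (Num.bound (K ^+ 2 + K + 1))%:R); last by rewrite ler_nat.
  by rewrite ltW // archi_boundP // !addr_ge0 ?sqr_ge0.
have K20 : 0 <= K ^+ 2 by exact: sqr_ge0.
have Fx := fP x rx.
have rho1 := rho_ge1 x; have rho0 := lt_le_trans ltr01 rho1.
have P1 : 1 <= rho x ^+ (msize f).-1 by rewrite exprn_ege1.
have cF : c <= peval f x by rewrite (le_trans _ Fx) // ler_peMr // ltW.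
have F0 : 0 < peval f x by exact: lt_le_trans cF.
have CF C : 0 <= C -> C <= C1 + C2 -> C * rho x ^+ (msize f).-1 <= K * peval f x.
  move=> C0 CC; apply: (@le_trans _ _ (K * (c * rho x ^+ (msize f).-1))).
    by rewrite /K mulrA divfK ?gt_eqF // ler_wpM2r // (le_trans ler01).
  by rewrite ler_wpM2l.
have d1 : `|dir1 f x v| * rho x <= K * peval f x * enorm v.
  by rewrite (le_trans (D1P x v)) // ler_wpM2r ?enorm_ge0 // CF // lerDl.
have d2 : `|dir2 f x v| * rho x ^+ 2 <= K * peval f x * enorm v ^+ 2.
  by rewrite (le_trans (D2P x v)) // enorm_sqr ler_wpM2r ?dot_ge0 // CF // lerDr.
rewrite dir2_phi -sqr_rho -enorm_sqr.
set F := peval f x in F0 cF d1 d2 *.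
set a := dot x v; set b := rho x * enorm v.
have t1 : - (K * F * `|a| * b) <= rho x ^+ 2 * a * dir1 f x v.
  rewrite lerNl (le_trans (ler_norm _)) // normrN (normrM _ (dir1 _ _ _)) (normrM _ a).
  rewrite normrX (gtr0_norm rho0).
  have -> : rho x ^+ 2 * `|a| * `|dir1 f x v| = (rho x * `|a|) * (`|dir1 f x v| * rho x).
    by ring.
  have -> : K * F * `|a| * b = (rho x * `|a|) * (K * F * enorm v) by rewrite /b; ring.
  by rewrite ler_wpM2l // mulr_ge0 // ltW.
have t2 : - (K * F * b ^+ 2) <= (rho x ^+ 2) ^+ 2 * dir2 f x v.
  rewrite lerNl (le_trans (ler_norm _)) // normrN (normrM _ (dir2 _ _ _)) !normrX (gtr0_norm rho0).
  have -> : (rho x ^+ 2) ^+ 2 * `|dir2 f x v| = rho x ^+ 2 * (`|dir2 f x v| * rho x ^+ 2).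
    by ring.
  have -> : K * F * b ^+ 2 = rho x ^+ 2 * (K * F * enorm v ^+ 2) by rewrite /b; ring.
  by rewrite ler_wpM2l // sqr_ge0.
set X := 4 * _ * _ * _ * _ + _ + _ + _.
have FX : F * enorm v ^+ 2 <= X.
  have Kl : K ^+ 2 <= M.+1%:R.
    by rewrite -natr1 (le_trans _ (lerD M0 ler01)) // -!addrA lerDl !addr_ge0.
  have Kk : K + 1 <= M.+2%:R.
    rewrite (le_trans (_ : _ <= K ^+ 2 + K + 1)) ?(le_trans M0) ?ler_nat ?leqW //.
    by rewrite -addrA lerDr.
  have := quadratic_form_ge (ler0n _ _) Kl Kk (ltW F0) t1 t2.
  rewrite (_ : _ + _ + _ + _ = X); last first.
    by rewrite /X /b; move: (M.+2)%:R (M.+1)%:R => k l; ring.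
  apply: le_trans; rewrite /b exprMn ler_pM2l // ler_peMl ?sqr_ge0 //.
  by rewrite exprn_ege1.
have vF : c * enorm v ^+ 2 <= F * enorm v ^+ 2 by rewrite ler_wpM2r ?sqr_ge0.
apply: (le_trans vF); apply: (le_trans FX).
rewrite ler_peMl ?exprn_ege1 ?exprn_ege1 //.
by rewrite (le_trans _ FX) // mulr_ge0 ?sqr_ge0 // ltW.
Qed.

Lemma convex_set_ball x (e : R) : convex_set (ball x e : set 'rV[R]_n).
Proof.
move=> y z t; rewrite !inE => -[e0 xy] [_ xz]; split=> // i j.
have := xy i j; have := xz i j; rewrite conv_rV !mxE /ball /= => xzj xyj.
have -> : x i j - (z i j + t%:num * (y i j - z i j)) =
    (1 - t%:num) * (x i j - z i j) + t%:num * (x i j - y i j) by ring.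
have t0 : 0 <= t%:num by exact: ge0.
have t1 : 0 <= 1 - t%:num by rewrite subr_ge0 le1.
rewrite (le_lt_trans (ler_normD _ _)) // !normrM (ger0_norm t0) (ger0_norm t1).
(* Strictness comes from the term with factor t, so t = 0 is treated apart. *)
have [->|tn0] := eqVneq t%:num 0; first by rewrite subr0 mul0r mul1r addr0.
have tp : 0 < t%:num by rewrite lt_neqAle eq_sym tn0.
have -> : e = (1 - t%:num) * e + t%:num * e by ring.
by rewrite ler_ltD ?ler_wpM2l ?ltr_pM2l // ltW.
Qed.

Lemma nbhs_ball_outside (r : R) x : 0 <= r -> r < enorm x ->
  exists2 e : R, 0 < e & forall y, ball x e y -> r < enorm y.
Proof.
move=> r0; rewrite lt_enorm // => rx.
have : nbhs x [set y | r ^+ 2 < dot y y].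
  exact: continuous_dot x _ (lt_nbhsr rx).
by move=> /nbhs_ballP [e /= e0 eP]; exists e => // y /eP; rewrite lt_enorm.
Qed.

Lemma locally_strongly_convex_phi f : f != 0 ->
    (forall x, x != 0 -> 0 < peval (leading_form f) x) ->
  exists2 r : R, 0 < r & exists N0 : nat, forall N : nat, (N0 <= N)%N ->
    locally_strongly_convex (phi f N) [set x | r < enorm x].
Proof.
move=> f0 /(dir2_phi_ge f0)[mu mu0 [r r0 [N0 D2]]].
exists r => //; exists N0 => N NN0 x /= rx.
have [e e0 eP] := nbhs_ball_outside (ltW r0) rx.
exists (ball x e); split; [exact: nbhsx_ballx|exact: convex_set_ball|exists mu => //].
by apply: convex_function_dir2 => [|y v /eP ry]; [exact: convex_set_ball|exact: D2].
Qed.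

(** Adding back mu/2 |.|^2 keeps convexity: |t y + (1 - t) z|^2 lies below its chord by t (1 - t) |y
    - z|^2. *)
Lemma locally_strongly_convexW p G : locally_strongly_convex p G -> Defs.locally_convex p G.
Proof.
move=> pG x /pG [U [xU cU [mu mu0 pU]]]; exists U; split=> // t y z yU zU.
have := pU t y z yU zU; rewrite !convRE conv_rV /unstable.onem !enorm_sqr.
have -> : dot (z + t%:num *: (y - z)) (z + t%:num *: (y - z)) =
    t%:num * dot y y + (1 - t%:num) * dot z z
      - t%:num * (1 - t%:num) * dot (y - z) (y - z).
  have [w ->] : exists w, y = w + z by exists (y - z); rewrite subrK.
  by rewrite addrK !(dotDl, dotDr, dotZl, dotZr) (dotC z w); ring.
have : 0 <= mu / 2 * (t%:num * (1 - t%:num) * dot (y - z) (y - z)).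
  have t0 : 0 <= t%:num by exact: ge0.
  by rewrite !mulr_ge0 ?dot_ge0 ?invr_ge0 ?subr_ge0 ?le1 // ltW.
move: (t%:num) (dot y y) (dot z z) (dot _ _) (peval _ _) (peval _ _) (peval _ _).
move=> s A B D a b c; lra.
Qed.

End StrongConvexity.

(** [a] and [b] only bound the degrees, so the formula survives a vanishing top coefficient, as may
    occur where f_d(x) = 0. *)
Lemma coef_mul_top (R : nzRingType) (p q : {poly R}) a b :
    (size p <= a.+1)%N -> (size q <= b.+1)%N ->
  (size (p * q)%R <= (a + b).+1)%N /\ (p * q)`_(a + b) = p`_a * q`_b.
Proof.
move=> pa qb; split.
  by rewrite (leq_trans (size_polyMleq _ _)) // -subn1 leq_subLR add1n -addnS -addSn leq_add.
have ab : (a < (a + b).+1)%N by rewrite ltnS leq_addr.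
rewrite coefM (bigD1 (Ordinal ab)) //= addKn big1 ?addr0 // => j ja.
have [lt_ja|lt_aj|eq_ja] := ltngtP j a.
- by rewrite [q`__]nth_default ?mulr0 // (leq_trans qb) // ltn_subRL ltn_add2r.
- by rewrite nth_default ?mul0r // (leq_trans pa).
- by case/eqP: ja; apply: val_inj.
Qed.

Lemma coef_exp_top (R : nzRingType) (p : {poly R}) a N : (size p <= a.+1)%N ->
  (size (p ^+ N)%R <= (N * a).+1)%N /\ (p ^+ N)`_(N * a) = p`_a ^+ N.
Proof.
move=> pa; elim: N => [|N [sN cN]]; first by rewrite !expr0 mul0n size_poly1 coef1.
have [] := coef_mul_top pa sN; rewrite -mulSn !exprS => -> ->.
by rewrite cN.
Qed.

(** Strict midpoint convexity of s^D at 1, 2 and 3; equality holds for D = 1. *)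
Lemma exp3_gt D : (2 <= D)%N -> (2 ^ D.+1 < 3 ^ D + 1)%N.
Proof.
elim: D => // D IHD; rewrite leq_eqVlt => /predU1P[<- //|/IHD].
by rewrite !expnS; lia.
Qed.

(** * From convexity at infinity to positivity of the leading form *)

Section ConvexAtInfinity.
Variables (R : realType) (n : nat).
Implicit Types (p f : {mpoly R[n]}) (x y v : 'rV[R]_n).

(** The exterior of a ball is not convex, but <x, y> >= 0 keeps the whole segment from 2 t x to 2 t
    y inside it for large t. Second derivatives are nonnegative there, and t (x + y) is the
    midpoint. *)
Lemma convex_at_infinity_midpoint p x y : convex_at_infinity p ->
    0 < dot x x -> 0 < dot y y -> 0 <= dot x y ->
  exists r : R, forall t, r < t ->
    2 * peval p (t *: (x + y)) <= peval p (t *: (2 *: x)) + peval p (t *: (2 *: y)).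
Proof.
move=> [r0 r00 pG] x0 y0 xy.
pose m := Num.min (dot x x) (dot y y).
have m0 : 0 < m by rewrite lt_min x0.
have mx : m <= dot x x by rewrite ge_min lexx.
have my : m <= dot y y by rewrite ge_min lexx orbT.
(* As (1 - s)^2 + s^2 >= 1/2, points of the segment have squared norm at least 2 t^2 m; this
   threshold gives t^2 >= t and t m > r0^2. *)
exists (1 + r0 ^+ 2 / m) => t rt.
have t1 : 1 <= t by rewrite (le_trans _ (ltW rt)) // lerDl divr_ge0 ?sqr_ge0 // ltW.
have tm : r0 ^+ 2 < t * m.
  by rewrite -ltr_pdivrMr // (le_lt_trans _ rt) // lerDr.
pose q := line p (t *: (2 *: x)) (t *: (2 *: y) - t *: (2 *: x)).
have q2 s : 0 <= s <= 1 -> 0 <= q^`()^`().[s].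
  move=> /andP[s0 s1]; rewrite deriv2_lineE; apply: (locally_convex_dir2_ge0 _ pG) => /=.
  rewrite lt_enorm // (lt_le_trans tm) //.
  have -> : t *: (2 *: x) + s *: (t *: (2 *: y) - t *: (2 *: x)) =
      (2 * t) *: ((1 - s) *: x + s *: y).
    by apply/rowP => i; rewrite !mxE; ring.
  rewrite !(dotDl, dotDr, dotZl, dotZr) (dotC y x).
  move: (dot x x) (dot y y) (dot x y) xy mx my => X Y Z Z0 mx my.
  have H1 : 0 <= (1 - s) ^+ 2 * (X - m) by rewrite mulr_ge0 ?sqr_ge0 ?subr_ge0.
  have H2 : 0 <= s ^+ 2 * (Y - m) by rewrite mulr_ge0 ?sqr_ge0 ?subr_ge0.
  have H3 : 0 <= (1 - s) * s * Z by rewrite !mulr_ge0 ?subr_ge0.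
  have H4 : 0 <= (2 * s - 1) ^+ 2 * m by rewrite mulr_ge0 ?sqr_ge0 // ltW.
  have H5 : m <= 2 * ((1 - s) ^+ 2 * X + s ^+ 2 * Y + 2 * ((1 - s) * s * Z)) by lra.
  have H6 : t * m <= t ^+ 2 * m by rewrite ler_pM2r // expr2 ler_peMr // (le_trans ler01).
  have H7 : t ^+ 2 * m <= t ^+ 2 * (2 * ((1 - s) ^+ 2 * X + s ^+ 2 * Y + 2 * ((1 - s) * s * Z))).
    by rewrite ler_wpM2l ?sqr_ge0.
  have H8 : 0 <= t ^+ 2 * (2 * ((1 - s) ^+ 2 * X + s ^+ 2 * Y + 2 * ((1 - s) * s * Z))).
    by apply: le_trans H7; rewrite mulr_ge0 ?sqr_ge0 // ltW.
  by apply: (le_trans H6); apply: (le_trans H7); lra.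
have := @poly_convex _ q 2^-1 q2; rewrite invr_ge0 ler0n invf_le1 ?ler1n // => /(_ isT).
rewrite !lineE scale0r addr0 scale1r subrKC.
have -> : t *: (2 *: x) + 2^-1 *: (t *: (2 *: y) - t *: (2 *: x)) = t *: (x + y).
  by apply/rowP => i; rewrite !mxE; field.
move: (peval _ _) (peval _ _) (peval _ _) => a b c; lra.
Qed.

Variables (f : {mpoly R[n]}) (N : nat).
Hypotheses (f0 : f != 0) (N0 : (0 < N)%N).
Let d := (msize f).-1.
Let L x := peval (leading_form f) x.
Let g x := dot x x ^+ N * L x.

Lemma dot_line0 x : dot_line 0 x = dot x x *: 'X^2.
Proof.
rewrite scaler_suml; apply: eq_bigr => i _.
by rewrite mxE add0r exprZn expr2.
Qed.

Lemma line0_phi x : (size (line (phi f N) 0 x) <= (N * 2 + d).+1)%N /\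
  (line (phi f N) 0 x)`_(N * 2 + d) = g x.
Proof.
have s2 : (size (1 + dot_line 0 x)%R <= 3)%N.
  rewrite dot_line0 (leq_trans (size_polyD _ _)) // size_poly1 geq_max.
  by rewrite (leq_trans (size_scale_leq _ _)) ?size_polyXn.
have c2 : (1 + dot_line 0 x)`_2 = dot x x.
  by rewrite dot_line0 coefD coef1 coefZ coefXn mulr1 add0r.
have sf : (size (line f 0 x) <= d.+1)%N.
  by rewrite (leq_trans (size_line0 f x)) // leqSpred.
have [s1 c1] := coef_exp_top N s2.
have [] := coef_mul_top s1 sf.
by rewrite line_phi c1 c2 (coef_line0 d f).
Qed.

Hypothesis cvx : convex_at_infinity (phi f N).

(** Both sides of the midpoint inequality for [phi f N] are polynomials in t of degree at most 2 N +
    d; comparing them for large t compares their coefficients of that degree. *)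
Lemma leading_form_midpoint x y :
    0 < dot x x -> 0 < dot y y -> 0 <= dot x y ->
  2 * g (x + y) <= g (2 *: x) + g (2 *: y).
Proof.
move=> x0 y0 xy; have [r rP] := convex_at_infinity_midpoint cvx x0 y0 xy.
pose l v := line (phi f N) 0 v.
have E : 0 <= (l (2 *: x) + l (2 *: y) - 2 *: l (x + y))`_(N * 2 + d).
  apply: (@poly_eventually_ge0_coef _ _ _ r) => [|t rt].
    rewrite (leq_trans (size_polyD _ _)) // geq_max size_polyN.
    rewrite (leq_trans (size_polyD _ _)) ?geq_max ?(leq_trans (size_scale_leq _ _)) //.
      by case: (line0_phi (x + y)).
    by rewrite (line0_phi (2 *: x)).1 (line0_phi (2 *: y)).1.
  rewrite hornerD hornerN hornerZ hornerD !lineE !add0r subr_ge0; exact: rP.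
move: E; rewrite coefB coefD coefZ !(line0_phi _).2 subr_ge0.
by [].
Qed.

Let gZ (a : R) x : g (a *: x) = a ^+ (N * 2 + d) * g x.
Proof.
rewrite /g dotZl dotZr /L peval_pihomogZ -/d exprD mulnC exprM !exprMn.
by rewrite -!exprMn; move: (_ ^+ d) => P; rewrite mulrA -expr2 !exprMn; ring.
Qed.

Lemma leading_form_ge0 x : 0 < dot x x -> 0 <= L x.
Proof.
move=> x0; have D2 : (2 <= N * 2 + d)%N by lia.
have x3 : 0 < dot (3 *: x) (3 *: x) by rewrite dotZl dotZr !mulr_gt0.
have xx3 : 0 <= dot x (3 *: x) by rewrite dotZr mulr_ge0 // ltW.
have := leading_form_midpoint x0 x3 xx3.
have -> : x + 3 *: x = 4 *: x by rewrite -{1}[x]scale1r -scalerDl; congr (_ *: _); ring.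
rewrite !gZ => gx.
(* With D = 2 N + d the inequality reads 2^(2 D + 1) g(x) <= (2^D + 6^D) g(x). The factors differ by
   2^D (3^D + 1 - 2^(D + 1)), positive since D >= 2. *)
have k0 : 0 < 2 ^+ (N * 2 + d) + 2 ^+ (N * 2 + d) * 3 ^+ (N * 2 + d) - 2 * 4 ^+ (N * 2 + d) :> R.
  have -> : 4 = 2 * 2 :> R by ring.
  move: (_ + d)%N D2 => D /exp3_gt; rewrite -(ltr_nat R) natrD !natrX exprS => D2.
  have A0 : 0 < 2 ^+ D :> R by rewrite exprn_gt0.
  rewrite exprMn; move: (2 ^+ D) (3 ^+ D) A0 D2 => A B A0 D2.
  have -> : A + A * B - 2 * (A * A) = A * (B + 1 - 2 * A) by ring.
  by rewrite mulr_gt0 // subr_gt0.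
have : 0 <= g x.
  rewrite -(pmulr_rge0 _ k0); clear k0; move: (2 ^+ _) (3 ^+ _) (4 ^+ _) (g x) gx => a b c z gx.
  lra.
by rewrite pmulr_rge0 ?exprn_gt0.
Qed.

Lemma leading_form_eq0 x y : 0 < dot x x -> L x = 0 -> 0 <= dot x y -> L y = 0.
Proof.
move=> x0 Lx xy.
have [->|yn0] := eqVneq y 0.
  by rewrite -[0](scale0r x) /L peval_pihomogZ [peval _ _]Lx mulr0.
have y0 := dot_gt0 yn0.
have Lyx t : 1 <= t -> 0 <= t * L (y + t *: x) <= g (2 *: y) / dot x x ^+ N.
  move=> t1; have t0 := lt_le_trans ltr01 t1.
  (* <x, y> >= 0 gives |y + t x|^2 >= t^2 |x|^2 >= t |x|^2. *)
  have tx : t * dot x x <= dot (y + t *: x) (y + t *: x).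
    rewrite !(dotDl, dotDr, dotZl, dotZr) (dotC y x).
    have : 0 <= dot y y + 2 * (t * dot x y) by rewrite addr_ge0 ?dot_ge0 // !mulr_ge0 // ltW.
    have : t * dot x x <= t * (t * dot x x) by rewrite ler_peMl // mulr_ge0 // ltW.
    by move: (dot y y) (dot x x) (t * dot x y) => Y X Z ? ?; lra.
  have L0 : 0 <= L (y + t *: x).
    by rewrite leading_form_ge0 // (lt_le_trans _ tx) // mulr_gt0.
  rewrite mulr_ge0 ?(ltW t0) //=.
  rewrite ler_pdivlMr ?exprn_gt0 //.
  have tx0 : 0 < dot (t *: x) (t *: x) by rewrite dotZl dotZr !mulr_gt0.
  have yx0 : 0 <= dot y (t *: x) by rewrite dotZr dotC mulr_ge0 // ltW.
  have gx : g x = 0 by rewrite /g Lx mulr0.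
  (* The term at 2 t x vanishes, leaving 2 g(y + t x) <= g(2 y), a bound independent of t. *)
  have := leading_form_midpoint y0 tx0 yx0; rewrite !(gZ _ (t *: x)) !(gZ _ x) gx !mulr0 addr0.
  have : t * L (y + t *: x) * dot x x ^+ N <= g (y + t *: x).
    rewrite mulrAC /g ler_wpM2r //.
    apply: (@le_trans _ _ ((t * dot x x) ^+ N)).
      rewrite exprMn ler_wpM2r ?exprn_ge0 ?(ltW x0) //.
      (* Here N >= 1 gives t <= t^N. *)
      by rewrite -[leLHS]expr1 ler_weXn2l.
    by rewrite lerXn2r ?nnegrE ?dot_ge0 // mulr_ge0 // ltW.
  have : 0 <= g (y + t *: x) by rewrite mulr_ge0 ?exprn_ge0 ?dot_ge0.
  move: (g _) (g _) (_ * _ * _) => a b c; lra.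
have q0 : line (leading_form f) y x = 0.
  apply: (@bounded_mulX_poly_eq0 _ _ (g (2 *: y) / dot x x ^+ N)) => t /Lyx /andP[? ?].
  by rewrite lineE ger0_norm.
by have := lineE (leading_form f) y x 0; rewrite q0 horner0 scale0r addr0.
Qed.

Lemma leading_form_gt0 x : x != 0 -> 0 < peval (leading_form f) x.
Proof.
move=> xn0; have x0 := dot_gt0 xn0.
rewrite lt_neqAle (leading_form_ge0 x0) andbT eq_sym; apply/eqP => Lx.
have/eqP := leading_form_neq0 f0; apply; apply: mpoly_vanish => y.
have [xy|xy] := leP 0 (dot x y); first exact: (leading_form_eq0 x0 Lx xy).
(* On the other half-space -x replaces x, since by homogeneity the form vanishes there too. *)
apply: (@leading_form_eq0 (-1 *: x)).
- by rewrite dotZl dotZr mulrA mulrNN !mul1r.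
- by rewrite /L peval_pihomogZ [peval _ _]Lx mulr0.
- by rewrite dotZl mulN1r oppr_ge0 ltW.
Qed.

End ConvexAtInfinity.

Theorem proposition5p3 (R : realType) (n : nat) (hn : (2 <= n)%N)
    (f : {mpoly R[n]}) (hf : f != 0) :
  [<-> forall x : 'rV[R]_n, x != 0 -> 0 < peval (leading_form f) x;
       exists2 r : R, 0 < r & exists N0 : nat, forall N : nat, (N0 <= N)%N ->
         locally_strongly_convex (phi f N) [set x | r < enorm x];
       exists N0 : nat, forall N : nat, (N0 <= N)%N ->
         convex_at_infinity (phi f N)].
Proof.
tfae.
- exact: locally_strongly_convex_phi.
- move=> [r r0 [N0 fN]]; exists N0 => N /fN fc.
  by exists r; [exact: ltW|exact: locally_strongly_convexW].
(* The successor provides the positive exponent that [leading_form_gt0] requires. *)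
- move=> [N0 fN]; apply: (@leading_form_gt0 _ _ _ N0.+1) => //.
  exact: fN.
Qed.
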